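(* Let $n\ge 1$, let $(V,E)$ be an ultrametric tree with root vertex $r$ constructed by Algorithm 1 (Ultrametric Tree Construction, described in the context) for an essentially ultrametric matrix $A\in\mathbb{R}^{n\times n}$, and let $x$ be a vector in $\mathbb{R}^n$. Then Algorithm 2 (Ultrametric Multiplication, described in the context) with input $(V,E)$ and $x$ terminates with output $y=Ax$.
   Context: A nonnegative (entrywise) symmetric matrix $A=[a_{ij}]\in\mathbb{R}^{n\times n}$ is called essentially ultrametric if $a_{ij}\ge\min\{a_{ik},a_{kj}\}$ for all $i,j,k$ with $i\neq j\neq k\neq i$ (pairwise distinct indices). No condition relates the diagonal entries to the off-diagonal entries. Algorithm 1 (Ultrametric Tree Construction). Input: an essentially ultrametric matrix $A=[a_{ij}]\in\mathbb{R}^{n\times n}$. Output: a directed graph $(V,E)$ (the ultrametric tree associated with $A$), each vertex $u\in V$ carrying an index set $I(u)$ and a value $f(u)$. Initialize $V\gets\{r\}$, $E\gets\emptyset$, $I(r)\gets\{1,\ldots,n\}$, and call TreeRecursion($r$). The procedure TreeRecursion($u$) does the following. Set $i\gets\min I(u)$. - If $|I(u)|=1$: set $f(u)\gets a_{ii}$ and return. - Otherwise: set $f(u)\gets\min\{a_{ij}: j\in I(u)\setminus\{i\}\}$; create two new vertices $v,w$ and set $V\gets V\cup\{v,w\}$, $E\gets E\cup\{(u,v),(u,w)\}$; set $I(v)\gets\{j\in I(u): a_{ij}>f(u)\}\cup\{i\}$ and $I(w)\gets\{j\in I(u)\setminus\{i\}: a_{ij}=f(u)\}$; call TreeRecursion($v$),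 then TreeRecursion($w$). Algorithm 2 (Ultrametric Multiplication). Input: a tree $(V,E)$ with root $r$ constructed by Algorithm 1 for $A$ (together with the data $I(u)$, $f(u)$ for $u\in V$), and a vector $x\in\mathbb{R}^n$. Output: a vector $y\in\mathbb{R}^n$. It assigns to each vertex $u$ additional values $s(u),t(u),p(u)$. It first calls PartialProduct($r,0$) and then TotalProduct($r,0$). - PartialProduct($u,z$): if $|I(u)|=1$, set $s(u)\gets x_i$ where $I(u)=\{i\}$; otherwise set $s(u)\gets\sum_{v\in V:(u,v)\in E}\text{PartialProduct}(v,f(u))$, the sum of the values returned by the recursive calls. Then set $t(u)\gets (f(u)-z)\,s(u)$ and return $s(u)$. - TotalProduct($u,q$): set $p(u)\gets q+t(u)$. If $|I(u)|=1$, set $y_i\gets p(u)$ where $I(u)=\{i\}$; otherwise call TotalProduct($v,p(u)$) for every $v\in V$ with $(u,v)\in E$. *)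

(* Defs.v *)
From HB Require Import structures.
From mathcomp Require Import all_boot all_order all_algebra.
From mathcomp Require Import finmap reals.

Set Implicit Arguments.
Unset Strict Implicit.
Unset Printing Implicit Defensive.

Import Order.TTheory GRing.Theory Num.Theory.

Local Open Scope fset_scope.
Local Open Scope ring_scope.

Definition essentially_ultrametric (R : realType) (n : nat) (A : 'M[R]_n) : Prop :=
  [/\ forall i j, 0 <= A i j,
      A^T = A
    & forall i j k, i != j -> j != k -> k != i ->
        Num.min (A i k) (A k j) <= A i j].

(* The directed graph (V, E) with the vertex data I(u) and f(u).  The maps
   [iset] and [fval] are total; only their values on [vset] matter. *)
Record labelled_graph (R : realType) (n : nat) (T : choiceType) := LabelledGraph {
  vset : {fset T};
  eset : {fset T * T};
  iset : T -> {set 'I_n};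
  fval : T -> R
}.

Section TreeConstruction.

Variables (R : realType) (n : nat) (T : choiceType) (A : 'M[R]_n).

Local Notation graph := (labelled_graph R n T).

Definition set_fval (g : graph) (u : T) (a : R) : graph :=
  LabelledGraph (vset g) (eset g) (iset g) [eta fval g with u |-> a].

Definition add_children (g : graph) (u v w : T) (J K : {set 'I_n}) : graph :=
  LabelledGraph (v |` (w |` vset g)) ((u, v) |` ((u, w) |` eset g))
    [eta iset g with v |-> J, w |-> K] (fval g).

Definition is_least (S : {set 'I_n}) (i : 'I_n) : Prop :=
  i \in S /\ forall j, j \in S -> (i <= j)%N.

Definition is_row_min (S : {set 'I_n}) (i : 'I_n) (a : R) : Prop :=
  (exists2 j, j \in S & A i j = a) /\ forall j, j \in S -> a <= A i j.

(* [tree_recursion g u g']: the call TreeRecursion(u), started in the state [g],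
   terminates in the state [g'].  The new vertices are arbitrary elements of [T]
   outside the current vertex set. *)
Inductive tree_recursion : graph -> T -> graph -> Prop :=
| TreeRecursionLeaf g u i :
    is_least (iset g u) i ->
    #|iset g u| = 1%N ->
    tree_recursion g u (set_fval g u (A i i))
| TreeRecursionNode g u i a v w g1 g2 g3 :
    is_least (iset g u) i ->
    #|iset g u| <> 1%N ->
    is_row_min (iset g u :\ i) i a ->
    v \notin vset g -> w \notin vset g -> v != w ->
    g1 = add_children (set_fval g u a) u v w
           (i |: [set j in iset g u | a < A i j])
           [set j in iset g u :\ i | A i j == a] ->
    tree_recursion g1 v g2 ->
    tree_recursion g2 w g3 ->
    tree_recursion g u g3.

Definition tree_construction (r : T) (g : graph) : Prop :=
  exists g0 : graph,
    [/\ vset g0 = [fset r], eset g0 = fset0, iset g0 r = [set: 'I_n]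
      & tree_recursion g0 r g].

End TreeConstruction.

Section Multiplication.

Variables (R : realType) (n : nat) (T : choiceType).

Record mult_state := MultState {
  sval_at : T -> R;
  tval_at : T -> R;
  pval_at : T -> R;
  yval_at : 'I_n -> R
}.

Definition set_st (m : mult_state) (u : T) (a b : R) : mult_state :=
  MultState [eta sval_at m with u |-> a] [eta tval_at m with u |-> b]
    (pval_at m) (yval_at m).

Definition set_p (m : mult_state) (u : T) (a : R) : mult_state :=
  MultState (sval_at m) (tval_at m) [eta pval_at m with u |-> a] (yval_at m).

Definition set_y (m : mult_state) (i : 'I_n) (a : R) : mult_state :=
  MultState (sval_at m) (tval_at m) (pval_at m) [eta yval_at m with i |-> a].

Fixpoint sum_calls (call : T -> mult_state -> option (mult_state * R))
    (vs : seq T) (m : mult_state) : option (mult_state * R) :=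
  if vs is v :: vs' then
    if call v m is Some (m1, a) then
      if sum_calls call vs' m1 is Some (m2, b) then Some (m2, a + b) else None
    else None
  else Some (m, 0).

Fixpoint iter_calls (call : T -> mult_state -> option mult_state)
    (vs : seq T) (m : mult_state) : option mult_state :=
  if vs is v :: vs' then obind (iter_calls call vs') (call v m) else Some m.

Variables (g : labelled_graph R n T) (x : 'cV[R]_n).

(* In both procedures [k] bounds the depth of the recursion, [None] means that
   the bound was exceeded, and [c u] lists the children of [u] in the order in
   which they are visited.  [unset1 I] is [Some i] iff [I = [set i]]. *)
Fixpoint partial_product (c : T -> seq T) (k : nat) (u : T) (z : R)
    (m : mult_state) : option (mult_state * R) :=
  if k is k'.+1 then
    let res :=
      if unset1 (iset g u) is Some i then Some (m, x i 0)
      else sum_calls (fun v => partial_product c k' v (fval g u)) (c u) m in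
    if res is Some (m', a) then Some (set_st m' u a ((fval g u - z) * a), a)
    else None
  else None.

Fixpoint total_product (c : T -> seq T) (k : nat) (u : T) (q : R)
    (m : mult_state) : option mult_state :=
  if k is k'.+1 then
    let a := q + tval_at m u in
    let m' := set_p m u a in
    if unset1 (iset g u) is Some i then Some (set_y m' i a)
    else iter_calls (fun v => total_product c k' v a) (c u) m'
  else None.

Definition ultrametric_multiplication (c1 c2 : T -> seq T) (k : nat) (r : T)
    (m0 : mult_state) : option 'cV[R]_n :=
  if partial_product c1 k r 0 m0 is Some (m1, _) then
    omap (fun m2 => \col_i yval_at m2 i) (total_product c2 k r 0 m1)
  else None.

Definition enumerates_children (c : T -> seq T) : Prop :=
  forall u, uniq (c u) /\
    forall v, (v \in c u) = (v \in vset g) && ((u, v) \in eset g).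

(* The loops over the children visit them in an unspecified order, and the
   vertex values and the output vector start out uninitialised: termination and
   the result are required for every order and every initial state. *)
Definition multiplication_terminates_with (r : T) (y : 'cV[R]_n) : Prop :=
  forall (c1 c2 : T -> seq T) (m0 : mult_state),
    enumerates_children c1 -> enumerates_children c2 ->
    exists N : nat, forall k : nat, (N <= k)%N ->
      ultrametric_multiplication c1 c2 k r m0 = Some y.

End Multiplication.

(* Main.v *)
Require Import Defs.
From mathcomp Require Import all_boot all_order all_algebra.
From mathcomp Require Import finmap reals.
From mathcomp Require Import ring.

Import Order.TTheory GRing.Theory Num.Theory.

Local Open Scope ring_scope.

(** The vertices of the tree carry nested blocks I(u) of indices, and the two
    children v, w of an inner vertex u split I(u) so that A is constantly equal
    to f(u) on the off-diagonal block I(v) x I(w) ([split_block_const]).  This is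
    where the ultrametric inequality is used: if i is the least index of I(u),
    j1 in I(v) is another index and j2 is in I(w), then of the three entries of A
    on {i, j1, j2} the two smallest coincide, and a_{i j1} > f(u) = a_{i j2}
    leaves a_{j1 j2} = f(u); for j1 = i this is the definition of I(w).

    Write s(u) for the sum of x over I(u).  TotalProduct(u, q) is called with
    t(u) = (f(u) - z) s(u), where z is the value at the parent, and writes

      y_i = q - z s(u) + sum_{j in I(u)} a_{ij} x_j      for i in I(u).

    At a leaf this is q + (a_ii - z) x_i.  At an inner vertex the child v
    receives p(u) = q + (f(u) - z) s(u) as its accumulator and f(u) as its parent
    value, so by induction y_i = p(u) - f(u) s(v) + sum_{j in I(v)} a_{ij} x_j
    for i in I(v); as s(u) = s(v) + s(w), the terms in f(u) combine to
    f(u) s(w), which is the part of row i over I(w).  At the root q = z = 0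
    and I(r) is everything, so y = A x.

    Both procedures work by mutation, so the rest of the argument is framing.
    The predicate [ultrametric_subtree] records what the multiplication needs
    about the finished graph, together with the set of vertices below u.
    A call of TreeRecursion changes only its argument and new vertices, so the
    subtree built for the first child survives the construction of the second
    ([tree_recursion_correct]).  Likewise the partial products of one child leave
    those of the other untouched ([partial_product_subtree]), and the two
    calls of TotalProduct write disjoint sets of entries of y
    ([total_product_subtree]). *)

(** * Blocks of an essentially ultrametric matrix *)

Set Implicit Arguments.
Unset Strict Implicit.

Section Blocks.

Context {R : realType} {n : nat} {A : 'M[R]_n}.

Lemma ultrametric_sym (hA : essentially_ultrametric A) i j : A i j = A j i.
Proof. by case: hA => _ tA _; rewrite -[in LHS]tA mxE. Qed.

(** Of the three off-diagonal entries on a triple of distinct indices, the two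
    smallest coincide; here A i j is known to exceed one of the others. *)
Lemma ultrametric_isosceles (hA : essentially_ultrametric A) i j k :
  i != j -> j != k -> k != i -> A i k < A i j -> A j k = A i k.
Proof.
move=> ij jk ki lt_kj; have [_ _ um] := hA.
apply/eqP; rewrite eq_le; apply/andP; split.
  have := um i k j; rewrite eq_sym ki eq_sym jk eq_sym ij => /(_ isT isT isT).
  by rewrite ge_min leNgt lt_kj.
have := um j k i; rewrite jk ki ij => /(_ isT isT isT).
by rewrite ultrametric_sym // (min_idPr (ltW lt_kj)).
Qed.

Variables (S : {set 'I_n}) (i : 'I_n) (a : R).
Hypotheses (iS : i \in S) (a_min : is_row_min A (S :\ i) i a).

Let high := i |: [set j in S | a < A i j].
Let low := [set j in S :\ i | A i j == a].

Lemma split_block_cover : S = high :|: low.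
Proof.
have [_ ge_a] := a_min; apply/setP => j; rewrite !inE.
have [-> //|ji] /= := eqVneq j i.
have [jS /=|//] := boolP (j \in S).
by have := ge_a j; rewrite !inE ji jS le_eqVlt orbC eq_sym => /(_ isT) ->.
Qed.

Lemma split_block_disjoint : [disjoint high & low].
Proof.
apply/pred0P => j /=; rewrite !inE.
have [//|ji] /= := eqVneq j i.
by have [->|_] := eqVneq (A i j) a; rewrite ?ltxx !andbF.
Qed.

(** This is [ultrametric_isosceles] on i, j, k, except when j is the index i
    itself; j = k is excluded by a < A i j and A i k = a. *)
Lemma split_block_const (hA : essentially_ultrametric A) :
  {in high & low, forall j k, A j k = a}.
Proof.
move=> j k; rewrite !inE => hj /andP[/andP[ki kS] /eqP aik].
have [->//|ji] := eqVneq j i.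
move: hj; rewrite (negPf ji) /= => /andP[_ lt_aj].
rewrite (@ultrametric_isosceles hA i j k) ?aik //; first by rewrite eq_sym.
by apply: contraTneq lt_aj => ->; rewrite aik ltxx.
Qed.

End Blocks.

(** * The tree left behind by the construction *)

Section Trees.

Context {R : realType} {n : nat} {T : choiceType} (A : 'M[R]_n).

Implicit Types (g : labelled_graph R n T) (u v w : T) (D : {fset T}).

(** The splitting is symmetric in the two children, because the procedures that
    consume the tree may visit them in either order. *)
Definition splits g u v w : Prop :=
  [/\ iset g u = iset g v :|: iset g w,
      [disjoint iset g v & iset g w],
      {in iset g v & iset g w, forall i j, A i j = fval g u}
    & {in iset g w & iset g v, forall i j, A i j = fval g u}].

(** [D] is the set of vertices below [u].  Recording it, with the disjointness
    of the sets of the two children, is what makes the frame arguments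
    possible. *)
Inductive ultrametric_subtree g : T -> {fset T} -> Prop :=
| SubtreeLeaf u i :
    u \in vset g ->
    (forall t, (u, t) \notin eset g) ->
    iset g u = [set i] ->
    fval g u = A i i ->
    ultrametric_subtree g u [fset u]%fset
| SubtreeNode u v w Dv Dw :
    u \in vset g ->
    #|iset g u| != 1%N ->
    v != w ->
    (forall t, ((u, t) \in eset g) = (t \in [:: v; w])) ->
    splits g u v w ->
    u \notin (Dv `|` Dw)%fset ->
    [disjoint Dv & Dw]%fset ->
    ultrametric_subtree g v Dv ->
    ultrametric_subtree g w Dw ->
    ultrametric_subtree g u (u |` (Dv `|` Dw))%fset.

Lemma subtree_root g u D : ultrametric_subtree g u D -> u \in D.
Proof. by case=> *; rewrite !inE eqxx. Qed.

Lemma subtree_vset g u D :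
  ultrametric_subtree g u D -> {in D, forall t, t \in vset g}.
Proof.
elim=> {u D} [u i uV _ _ _ t|u v w Dv Dw uV _ _ _ _ _ _ _ IHv _ IHw t].
  by rewrite inE => /eqP->.
by rewrite !inE => /or3P[/eqP->//|/IHv|/IHw].
Qed.

Lemma subtree_edge_closed g u D :
  ultrametric_subtree g u D ->
  {in D, forall s t, (s, t) \in eset g -> t \in D}.
Proof.
elim=> {u D} [u i _ noE _ _ s|u v w Dv Dw _ _ _ uE _ _ _ tv IHv tw IHw s].
  by rewrite inE => /eqP-> t; rewrite (negPf (noE t)).
rewrite !inE => /or3P[/eqP->|sD|sD] t; last 2 first.
- by move/(IHv _ sD); rewrite !inE => ->; rewrite orbT.
- by move/(IHw _ sD); rewrite !inE => ->; rewrite !orbT.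
rewrite uE !inE => /orP[] /eqP->.
  by rewrite (subtree_root tv) orbT.
by rewrite (subtree_root tw) !orbT.
Qed.

Definition same_at g g' t : Prop :=
  [/\ t \in vset g', iset g' t = iset g t, fval g' t = fval g t
    & forall s, ((t, s) \in eset g') = ((t, s) \in eset g)].

(** A subtree depends on the graph only through the data at its own vertices
    and their outgoing edges, so it is insensitive to changes elsewhere. *)
Lemma subtree_transport g g' u D :
  ultrametric_subtree g u D -> {in D, forall t, same_at g g' t} ->
  ultrametric_subtree g' u D.
Proof.
elim=> {u D} [u i _ noE Iu fu|u v w Dv Dw _ I1 vw uE sp uD dis tv IHv tw IHw] eqg.
  have [uV' Iu' fu' E'] := eqg u (fset11 u).
  apply: (@SubtreeLeaf _ _ i) => //; rewrite ?Iu' ?fu' //.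
  by move=> t; rewrite E'.
have [uV' Iu' fu' E'] := eqg u (fset1U1 _ _).
have [|vV' Iv' _ _] := eqg v.
  by rewrite !inE (subtree_root tv) orbT.
have [|wV' Iw' _ _] := eqg w.
  by rewrite !inE (subtree_root tw) !orbT.
apply: (@SubtreeNode _ _ v w) => //; rewrite ?Iu' //.
- by move=> t; rewrite E'.
- by rewrite /splits Iu' Iv' Iw' fu'.
- by apply: IHv => t tD; apply: eqg; rewrite !inE tD orbT.
- by apply: IHw => t tD; apply: eqg; rewrite !inE tD !orbT.
Qed.

(** A call of TreeRecursion on [u] may change the data of [u] and of new
    vertices only. *)
Definition frame g u g' : Prop :=
  [/\ {in vset g, forall t, t \in vset g'},
      {in vset g, forall t, iset g' t = iset g t}
    & {in vset g, forall t, t != u -> same_at g g' t}].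

(** An invariant of the construction: it guarantees that a vertex about
    to be created has no outgoing edge. *)
Definition sources_in_vset g : Prop :=
  forall s t, (s, t) \in eset g -> s \in vset g.

(** Besides the subtree at [u], the induction has to carry where its vertices
    come from: apart from [u] they are new.  Hence the vertices below the first
    child [v] avoid [w], which lets their subtree be transported through the
    call on [w], and the vertices below [w] are disjoint from them. *)
Lemma tree_recursion_correct (hA : essentially_ultrametric A) g u g' :
  tree_recursion A g u g' ->
  u \in vset g -> (forall t, (u, t) \notin eset g) -> sources_in_vset g ->
  [/\ frame g u g', sources_in_vset g'
    & exists2 D, ultrametric_subtree g' u D
        & {in D, forall t, t = u \/ t \notin vset g}].
Proof.
elim=> {g u g'} [g u i [iI _] I1|g u i a v w g1 g2 g3 [iI _] I1 a_min vV wV vw eg1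
  _ IHv _ IHw] uV noE srcE.
  split=> //.
    split=> // t tV tu; split=> //=.
    by rewrite (negPf tu).
  exists [fset u]%fset; last by move=> t; rewrite inE => /eqP; left.
  apply: (@SubtreeLeaf _ _ i) => //=; last by rewrite eqxx.
  move/eqP/cards1P: I1 => [j eI]; move: iI.
  by rewrite eI inE => /eqP->.
have uv : u != v by apply: contraNneq vV => <-.
have uw : u != w by apply: contraNneq wV => <-.
have neV t x : x \notin vset g -> t \in vset g -> t != x.
  by move=> xV tV; apply: contraNneq xV => <-.
have V1 t : (t \in vset g1) = [|| t == v, t == w | t \in vset g].
  by rewrite eg1 /= !inE.
have E1 s t : ((s, t) \in eset g1) =
    (s == u) && (t \in [:: v; w]) || ((s, t) \in eset g).
  by rewrite eg1 /= !inE !xpair_eqE andb_orr orbA.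
have src1 : sources_in_vset g1.
  move=> s t; rewrite E1 V1 => /orP[/andP[/eqP-> _]|/srcE->].
    by rewrite uV !orbT.
  by rewrite !orbT.
have noEv t : (v, t) \notin eset g1.
  by rewrite E1 eq_sym (negPf uv) /=; apply: contra vV; apply: srcE.
have noEw t : (w, t) \notin eset g1.
  by rewrite E1 eq_sym (negPf uw) /=; apply: contra wV; apply: srcE.
have v1 : v \in vset g1 by rewrite V1 eqxx.
have w1 : w \in vset g1 by rewrite V1 eqxx orbT.
have u1 : u \in vset g1 by rewrite V1 uV !orbT.
have [[V12 I12 same12] src2 [Dv tv newv]] := IHv v1 noEv src1.
have wv : w != v by rewrite eq_sym.
have noEw2 t : (w, t) \notin eset g2.
  by have [_ _ _ ->] := same12 w w1 wv.
have [[V23 I23 same23] src3 [Dw tw neww]] := IHw (V12 _ w1) noEw2 src2.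
have same13 t : t \in vset g1 -> t != v -> t != w -> same_at g1 g3 t.
  move=> t1 tnv tnw.
  have [t2 I2 f2 E2] := same12 t t1 tnv.
  have [t3 I3 f3 E3] := same23 t t2 tnw.
  by split; rewrite ?t3 ?I3 ?f3 // => s; rewrite E3.
have I13 t : t \in vset g1 -> iset g3 t = iset g1 t.
  by move=> t1; rewrite I23 ?I12 //; apply: V12.
have I01 t : t \in vset g -> iset g1 t = iset g t.
  by move=> tV; rewrite eg1 /= (negPf (neV _ _ vV tV)) (negPf (neV _ _ wV tV)).
have gg1 t : t \in vset g -> t \in vset g1 by move=> tV; rewrite V1 tV !orbT.
have [u3 Iu3 fu3 Eu3] := same13 u u1 uv uw.
have fu : fval g3 u = a by rewrite fu3 eg1 /= eqxx.
have Iv : iset g3 v = i |: [set j in iset g u | a < A i j].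
  by rewrite I13 // eg1 /= eqxx.
have Iw : iset g3 w = [set j in iset g u :\ i | A i j == a].
  by rewrite I13 // eg1 /= (negPf wv) eqxx.
split=> //.
  split=> [t tV|t tV|t tV tu].
  - by apply/V23/V12/gg1.
  - by rewrite I13 ?I01 // gg1.
  have [t3 It ft Et] := same13 t (gg1 t tV) (neV _ _ vV tV) (neV _ _ wV tV).
  split=> //; first by rewrite It I01.
    by rewrite ft eg1 /= (negPf tu).
  by move=> s; rewrite Et E1 (negPf tu).
exists (u |` (Dv `|` Dw))%fset; last first.
  move=> t; rewrite !inE => /or3P[/eqP->|/newv tD|/neww tD]; first by left.
    right; case: tD => [->//|]; apply: contra; exact: gg1.
  right; case: tD => [->//|]; apply: contra => tV; exact/V12/gg1.
have wDv : w \notin Dv.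
  by apply/negP => /newv[/eqP|]; rewrite ?(negPf wv) // w1.
apply: (@SubtreeNode _ _ v w) => //.
- by rewrite Iu3 I01 //; apply/eqP.
- move=> t; rewrite Eu3 E1 eqxx /= (negPf (noE t)) orbF //.
- rewrite /splits Iu3 I01 // Iv Iw fu.
  have const := @split_block_const _ _ A (iset g u) i a hA.
  split; first exact: split_block_cover.
  + exact: split_block_disjoint.
  + exact: const.
  + by move=> j k jI kI; rewrite ultrametric_sym //; apply: const kI jI.
- rewrite inE; apply/norP; split; apply/negP.
    by move=> /newv[/eqP|]; rewrite ?(negPf uv) // u1.
  by move=> /neww[/eqP|]; rewrite ?(negPf uw) // V12.
- apply/fdisjointP => t tD; apply/negP => /neww[tw'|].
    by move: wDv; rewrite -tw' tD.
  by rewrite (subtree_vset tv).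
- apply: (subtree_transport tv) => t tD; apply: same23.
    exact: (subtree_vset tv).
  by apply: contraTneq tD => ->.
Qed.

Lemma tree_construction_correct (hA : essentially_ultrametric A) r g :
  tree_construction A r g ->
  iset g r = [set: 'I_n] /\ exists D, ultrametric_subtree g r D.
Proof.
move=> [g0 [V0 E0 I0 rec]].
have r0 : r \in vset g0 by rewrite V0 inE.
case: (tree_recursion_correct hA rec) => //.
- by move=> t; rewrite E0 inE.
- by move=> s t; rewrite E0 inE.
move=> [_ I' _] _ [D tD _]; split; first by rewrite I'.
by exists D.
Qed.

(** * The two passes of the multiplication *)

Variables (g : labelled_graph R n T) (x : 'cV[R]_n).

Definition block_sum u : R := \sum_(j in iset g u) x j 0.

Lemma splits_sum u v w (F : 'I_n -> R) :
  splits g u v w ->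
  \sum_(j in iset g u) F j = \sum_(j in iset g v) F j + \sum_(j in iset g w) F j.
Proof.
case=> eI dis _ _; rewrite -bigU //=.
by apply: eq_bigl => j; rewrite eI !inE.
Qed.

(** What the first pass leaves for the second one: on every edge (s, t) with
    s in [D], the value z in t(t) = (f(t) - z) s(t) is that of the
    parent. *)
Definition edge_weights (D : {fset T}) (m : mult_state R n T) : Prop :=
  {in D, forall s t, (s, t) \in eset g ->
    tval_at m t = (fval g t - fval g s) * block_sum t}.

Lemma children_order c u v w :
  enumerates_children g c -> v \in vset g -> w \in vset g -> v != w ->
  (forall t, ((u, t) \in eset g) = (t \in [:: v; w])) ->
  c u = [:: v; w] \/ c u = [:: w; v].
Proof.
move=> /(_ u)[Uc memc] vV wV vw uE.
have eqc : c u =i [:: v; w].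
  move=> t; rewrite memc uE !inE.
  by have [->|] := eqVneq t v; rewrite ?vV //; have [->|] := eqVneq t w; rewrite ?wV ?andbF.
have pc : perm_eq (c u) [:: v; w] by apply: uniq_perm; rewrite //= inE vw.
have := perm_size pc; move: {pc} Uc eqc; case: (c u) => [|a [|b []]] //=.
rewrite inE andbT => ab eqc _.
have := eqc a; have := eqc b; rewrite !inE !eqxx orbT /=.
by do 2![move=> /esym/orP[]/eqP ?]; subst; auto; rewrite eqxx in ab.
Qed.

Lemma splits_sym u v w : splits g u v w -> splits g u w v.
Proof. by case=> eI dis cvw cwv; split; rewrite // 1?setUC // disjoint_sym. Qed.

(** The state [m'] is chosen before the bound [k], so that the second pass can
    start from one state for all large [k].  The second conclusion lets the
    result of the child visited first survive the visit of the other one. *)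
Lemma partial_product_subtree c u D :
  enumerates_children g c -> ultrametric_subtree g u D ->
  forall z m, exists N m',
    [/\ forall k, (N <= k)%N ->
          partial_product g x c k u z m = Some (m', block_sum u),
        forall t, t \notin D -> tval_at m' t = tval_at m t,
        tval_at m' u = (fval g u - z) * block_sum u
      & edge_weights D m'].
Proof.
move=> cE; elim=> {u D} [u i uV noE Iu fu z m|
    u v w Dv Dw uV I1 vw uE sp uD dis tv IHv tw IHw z m].
  have bu : block_sum u = x i 0 by rewrite /block_sum Iu big_set1.
  exists 1%N, (set_st m u (x i 0) ((fval g u - z) * x i 0)).
  split=> [[|k] //= _|t|/=|s].
  - by rewrite Iu set1K bu.
  - by rewrite inE /= => /negPf->.
  - by rewrite eqxx bu.
  - by rewrite inE => /eqP-> t; rewrite (negPf (noE t)).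
have [vD wD] := (subtree_root tv, subtree_root tw).
have [vV wV] := (subtree_vset tv vD, subtree_vset tw wD).
(* the hypotheses on v and w are symmetric, so the order of the visits may be
   fixed *)
wlog cu : v w Dv Dw vw uE sp uD dis tv IHv tw IHw vD wD vV wV / c u = [:: v; w].
  move=> W; have [cu|cu] := children_order cE vV wV vw uE; first exact: (W v w).
  rewrite (fsetUC Dv); apply: (W w v) => //.
  - by rewrite eq_sym.
  - by move=> t; rewrite uE !inE orbC.
  - exact: splits_sym.
  - by rewrite fsetUC.
  - by rewrite fdisjoint_sym.
have [N1 [m1 [run1 out1 tv1 ew1]]] := IHv (fval g u) m.
have [N2 [m2 [run2 out2 tw2 ew2]]] := IHw (fval g u) m1.
have [uDv uDw] : u \notin Dv /\ u \notin Dw.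
  by move: uD; rewrite inE negb_or => /andP.
have neu t : t \in (Dv `|` Dw)%fset -> t != u.
  by move=> tD; apply: contraNneq uD => <-.
have tvu s : s \in Dv -> tval_at m2 s = tval_at m1 s.
  by move=> sD; apply: out2; apply: (fdisjointP dis).
set b := (fval g u - z) * block_sum u.
exists (maxn N1 N2).+1, (set_st m2 u (block_sum u) b).
split=> [[|k] // le_k|t|/=|s].
- rewrite /= unset1N1 // cu /= run1 ?run2 ?addr0 -?(splits_sum _ sp) //.
    exact: leq_trans (leq_maxr _ _) le_k.
  exact: leq_trans (leq_maxl _ _) le_k.
- by rewrite !inE !negb_or /= => /and3P[/negPf-> tv' tw']; rewrite out2 ?out1.
- by rewrite eqxx.
move=> sD t st.
have tD : t != u.
  apply: neu; move: sD st; rewrite !inE => /or3P[/eqP->|sD|sD].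
  - by rewrite uE !inE => /orP[]/eqP->; rewrite ?vD ?wD ?orbT.
  - by move/(subtree_edge_closed tv sD) ->.
  - by move/(subtree_edge_closed tw sD) ->; rewrite orbT.
rewrite /= (negPf tD); move: sD st; rewrite !inE => /or3P[/eqP->|sD|sD] st.
- move: st; rewrite uE !inE => /orP[]/eqP-> //; by rewrite tvu.
- by rewrite tvu ?(ew1 _ sD) //; apply: (subtree_edge_closed tv sD).
- exact: ew2.
Qed.

(** The value of [yval_at] is the formula that closes under the passage to a
    child, whose accumulator is q + (f(u) - z) s(u) and whose parent value is
    f(u).  The last conclusion protects the entries written for the child
    visited first. *)
Lemma total_product_subtree c u D :
  enumerates_children g c -> ultrametric_subtree g u D ->
  forall z q m,
    tval_at m u = (fval g u - z) * block_sum u -> edge_weights D m ->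
  exists N m',
    [/\ forall k, (N <= k)%N -> total_product g c k u q m = Some m',
        tval_at m' = tval_at m,
        {in iset g u, forall i,
           yval_at m' i = q - z * block_sum u + \sum_(j in iset g u) A i j * x j 0}
      & forall i, i \notin iset g u -> yval_at m' i = yval_at m i].
Proof.
move=> cE; elim=> {u D} [u i uV noE Iu fu z q m tu _|
    u v w Dv Dw uV I1 vw uE sp uD dis tv IHv tw IHw z q m tu ew].
  have bu : block_sum u = x i 0 by rewrite /block_sum Iu big_set1.
  set a := q + tval_at m u.
  exists 1%N, (set_y (set_p m u a) i a).
  split=> [[|k] //= _|//|j|j]; rewrite Iu ?set1K // inE.
    move=> /eqP->; rewrite /= eqxx big_set1 /a tu bu fu; ring.
  by move=> /negPf /= ->.
have [vD wD] := (subtree_root tv, subtree_root tw).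
have [vV wV] := (subtree_vset tv vD, subtree_vset tw wD).
wlog cu : v w Dv Dw vw uE sp uD dis tv IHv tw IHw ew vD wD vV wV / c u = [:: v; w].
  move=> W; have [cu|cu] := children_order cE vV wV vw uE; first exact: (W v w Dv Dw).
  apply: (W w v Dw Dv) => //.
  - by rewrite eq_sym.
  - by move=> t; rewrite uE !inE orbC.
  - exact: splits_sym.
  - by rewrite fsetUC.
  - by rewrite fdisjoint_sym.
  - by rewrite (fsetUC Dw).
set a := q + tval_at m u.
have u_in : u \in (u |` (Dv `|` Dw))%fset by rewrite fset1U1.
have [|s sD|N1 [m1 [run1 t1 y1 out1]]] := IHv (fval g u) a (set_p m u a).
- by rewrite /= (ew u) // uE !inE eqxx.
- by apply: ew; rewrite !inE sD orbT.
have [||N2 [m2 [run2 t2 y2 out2]]] := IHw (fval g u) a m1.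
- by rewrite t1 /= (ew u) // uE !inE eqxx orbT.
- by move=> s sD t st; rewrite t1 /=; apply: ew; rewrite // !inE sD !orbT.
have bs : block_sum u = block_sum v + block_sum w := splits_sum _ sp.
have [eI disI cvw cwv] := sp.
exists (maxn N1 N2).+1, m2; split=> [[|k] // le_k||i|i].
- rewrite /= unset1N1 // cu /= run1 /= ?run2 //.
    exact: leq_trans (leq_maxr _ _) le_k.
  exact: leq_trans (leq_maxl _ _) le_k.
- by rewrite t2 t1.
- rewrite (splits_sum _ sp) {1}eI inE => /orP[iv|iw].
    rewrite out2 ?(disjointFr disI) // y1 // /a tu bs.
    rewrite (eq_bigr (fun j => fval g u * x j 0) (P := mem (iset g w))); last first.
      by move=> j jw; rewrite cvw.
    rewrite -mulr_sumr -/(block_sum w); ring.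
  rewrite y2 // /a tu bs.
  rewrite (eq_bigr (fun j => fval g u * x j 0) (P := mem (iset g v))); last first.
    by move=> j jv; rewrite cwv.
  rewrite -mulr_sumr -/(block_sum v); ring.
- by rewrite eI inE negb_or => /andP[iv iw]; rewrite out2 ?out1.
Qed.

End Trees.

Unset Implicit Arguments.
Set Strict Implicit.

Theorem theorem3p1 (R : realType) (n : nat) (hn : (1 <= n)%N)
    (A : 'M[R]_n) (hA : essentially_ultrametric A)
    (T : choiceType) (r : T) (g : labelled_graph R n T)
    (hg : tree_construction A r g) (x : 'cV[R]_n) :
  multiplication_terminates_with g x r (A *m x).
Proof.
move=> c1 c2 m0 cE1 cE2.
have [Ir [D tr]] := tree_construction_correct hA hg.
have [N1 [m1 [run1 _ tv1 ew1]]] := partial_product_subtree x cE1 tr 0 m0.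
have [N2 [m2 [run2 _ y2 _]]] := total_product_subtree cE2 tr 0 tv1 ew1.
exists (maxn N1 N2) => k; rewrite geq_max => /andP[le1 le2].
rewrite /ultrametric_multiplication run1 // run2 //=; congr Some.
apply/matrixP => i j; rewrite !mxE y2 ?Ir // mul0r subr0 add0r ord1.
by apply: eq_bigl => k'; rewrite inE.
Qed.
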